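(* Let $K$ be a field and $S=K[x_1,\ldots,x_n]$. Let $\mathcal F$ be a non-empty set of subsets of $[n]=\{1,\ldots,n\}$ with $\emptyset\notin\mathcal F$, and assume that $\mathcal F$ satisfies the condition $$A\cup B\in\mathcal F\quad\text{for all } A,B\in\mathcal F \text{ with } A\cap B\neq\emptyset. \qquad ( * )$$ Then there exists a transversal polymatroidal ideal $I\subset S$ such that $\operatorname{Ass}(I)=\{P_A : A\in\mathcal F\}$. Conversely, given any transversal polymatroidal ideal $I\subset S$, the set $\{A : A\subset[n]\text{ and }P_A\in\operatorname{Ass}(I)\}$ satisfies condition $( * )$ (in place of $\mathcal F$).
   Context: For a non-empty subset $F\subset[n]$, $P_F=(x_i : i\in F)$. A transversal polymatroidal ideal is an ideal of the form $I=P_{F_1}\cdots P_{F_r}$, where $r\ge1$ and $F_1,\ldots,F_r$ is a collection of non-empty, not necessarily distinct, subsets of $[n]$. $\operatorname{Ass}(I)$ denotes the set of associated prime ideals of $S/I$. *)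

(* Defs.v *)
From mathcomp Require Export all_boot all_order all_algebra.
From mathcomp Require Export boolp classical_sets.
From mathcomp Require Export mpoly.

Set Implicit Arguments.
Unset Strict Implicit.
Unset Printing Implicit Defensive.

Import GRing.Theory.
Local Open Scope ring_scope.
Local Open Scope classical_set_scope.

Section Ideals.
Variable R : comNzRingType.
Implicit Types (I J P G : set R) (f : R).

(* mathcomp's [idealr_closed] excludes the unit ideal; here [setT] is an
   ideal, as an ideal is an R-submodule of R. *)
Definition is_ideal I : Prop := submod_closed (mem I : {pred R^o}).

Definition is_prime_ideal P : Prop :=
  idealr_closed (mem P) /\ prime_idealr_closed (mem P).

Definition ideal_gen G : set R := smallest is_ideal G.

Definition ideal_mul I J : set R := ideal_gen [set a * b | a in I & b in J].

(* The annihilator in R of the class f + I of the R-module R/I. *)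
Definition ann_class I f : set R := [set a | I (a * f)].

(* The associated primes of the R-module R/I: the prime ideals that are
   the annihilator of an element of R/I. *)
Definition Ass I : set (set R) :=
  [set P | is_prime_ideal P /\ exists f, P = ann_class I f].

End Ideals.

Section Transversal.
Variables (K : fieldType) (n : nat).

(* The variables are indexed by 'I_n, that is, from 0 to n - 1. *)
Definition varideal (A : {set 'I_n}) : set {mpoly K[n]} :=
  ideal_gen [set 'X_i | i in [set` A]].

(* [setT], the unit ideal, is the neutral element of the product of ideals. *)
Definition transversal_polymatroidal (I : set {mpoly K[n]}) : Prop :=
  exists (r : nat) (F : 'I_r -> {set 'I_n}),
    [/\ (0 < r)%N, forall i, F i != finset.set0
      & I = \big[@ideal_mul {mpoly K[n]}/setT]_(i < r) varideal (F i)].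

End Transversal.

Arguments varideal K {n} A.

Definition meeting_union_closed (n : nat) (F : set {set 'I_n}) : Prop :=
  forall A B, F A -> F B -> A :&: B != finset.set0 -> F (A :|: B).

(* Main.v *)
(* Let I be the product of the ideals P_(F j), and join two indices j, k by an
   edge when F j and F k meet.  By Hall's theorem a monomial lies in I iff, for
   each connected set J of indices with union A, its degree in the variables of
   A is at least #|J|; that is, I is the intersection of the P_A-primary ideals
   P_A ^ #|J|.  Hence every associated prime is such a P_A.  Conversely,
   a spanning tree of the set of all j with F j included in A yields a monomial
   whose annihilator modulo I is P_A.  So the associated primes of I are exactly
   the P_A with A a connected union, and two connected unions that meet have
   a connected union. *)
Require Import Defs.
From mathcomp Require Import ring.

Set Implicit Arguments.
Unset Strict Implicit.
Unset Printing Implicit Defensive.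

Section Combinatorics.
Import boot.fintype boot.finset.
Variable n : nat.
Implicit Types (A B : {set 'I_n}) (m : 'X_{1..n}).

(** * Degree of a monomial in a set of variables *)

Definition deg A m := \sum_(i in A) m i.

Lemma deg0 A : deg A 0%MM = 0.
Proof. by rewrite /deg big1 // => i _; rewrite mnm0E. Qed.

Lemma degD A m1 m2 : deg A (m1 + m2)%MM = deg A m1 + deg A m2.
Proof. by rewrite /deg -big_split; apply: eq_bigr => i _; rewrite mnmDE. Qed.

Lemma deg_sum A (I : Type) (s : seq I) (P : pred I) (f : I -> 'X_{1..n}) :
  deg A (\sum_(j <- s | P j) f j)%MM = \sum_(j <- s | P j) deg A (f j).
Proof. exact: (big_morph (deg A) (degD A) (deg0 A)). Qed.

Lemma degMn A m k : deg A (m *+ k)%MM = deg A m * k.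
Proof.
by rewrite /deg big_distrl /=; apply: eq_bigr => i _; rewrite mulmnE.
Qed.

Lemma degU A i : deg A U_(i)%MM = (i \in A).
Proof.
rewrite /deg; case: (boolP (i \in A)) => iA; last first.
  rewrite big1 // => j jA; rewrite mnm1E; case: eqP => // ij.
  by rewrite ij jA in iA.
rewrite (bigD1 i) //= mnm1E eqxx big1 // => j /andP [_ ji].
by rewrite mnm1E eq_sym (negPf ji).
Qed.

Lemma leq_deg A m1 m2 : (m1 <= m2)%MM -> deg A m1 <= deg A m2.
Proof. by move/mnm_lepP => le12; apply: leq_sum. Qed.

Lemma deg_subset A B m : A \subset B -> deg A m <= deg B m.
Proof.
by move=> sAB; rewrite /deg [leqRHS](big_setID A) /= (setIidPr sAB) leq_addr.
Qed.

Lemma degUI A B m : [disjoint A & B] -> deg (A :|: B) m = deg A m + deg B m.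
Proof. move=> dAB; rewrite /deg (big_setID A) /= setUK.
by rewrite setDUl setDv set0U (setDidPl _) // disjoint_sym. Qed.

Lemma deg_mdeg A m : deg A m <= mdeg m.
Proof. rewrite mdegE [leqRHS](bigID (fun i => i \in A)) /=; exact: leq_addr. Qed.

Lemma deg_gt0P A m : reflect (exists2 i, i \in A & 0 < m i) (0 < deg A m).
Proof.
apply: (iffP idP) => [|[i iA mi]]; last by rewrite /deg (bigD1 i) //= ltn_addr.
rewrite lt0n sum_nat_eq0 negb_forall => /existsP [i].
by rewrite negb_imply -lt0n => /andP [iA mi]; exists i.
Qed.

Definition restr A m : 'X_{1..n} := [multinom if i \in A then m i else 0 | i < n].

Lemma deg_restr A B m : deg A (restr B m) = deg (A :&: B) m.
Proof.
rewrite /deg; under eq_bigr do rewrite mnmE.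
rewrite (big_setID B) /= [X in _ + X]big1 ?addn0 => [|i]; last first.
  by rewrite inE => /andP [/negPf ->].
by apply: eq_bigr => i; rewrite inE => /andP [_ ->].
Qed.

Lemma restr_setC A m : (restr A m + restr (~: A) m)%MM = m.
Proof. by apply/mnmP => i; rewrite mnmDE !mnmE inE; case: ifP; rewrite ?addn0. Qed.

(** * Monomials of a product of ideals of variables: Hall's theorem and connected index sets *)

Variables (T : finType) (F : T -> {set 'I_n}).
Implicit Types (J X Y : {set T}).

Definition cov J := \bigcup_(j in J) F j.

Lemma cov1 j : cov [set j] = F j.
Proof. exact: big_set1. Qed.

Lemma covU X Y : cov (X :|: Y) = cov X :|: cov Y.
Proof. exact: bigcup_setU. Qed.

Lemma cov_sup J j : j \in J -> F j \subset cov J.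
Proof. by move=> jJ; apply: bigcup_sup. Qed.

Lemma covS X Y : X \subset Y -> cov X \subset cov Y.
Proof. by move/setUidPr <-; rewrite covU subsetUl. Qed.

(* The monomials of the product of the [varideal K (F j)] with [j] in [J]; [phi j]
   is the factor taken in [varideal K (F j)]. *)
Definition transversal_mnm J m := exists phi : T -> 'X_{1..n},
  (forall j, j \in J -> 0 < deg (F j) (phi j)) /\ (\sum_(j in J) phi j <= m)%MM.

Lemma transversal_mnm_le J m m' :
  (m <= m')%MM -> transversal_mnm J m -> transversal_mnm J m'.
Proof.
by move=> le_m [phi [phiF le_phi]]; exists phi; split=> //; apply: lepm_trans le_m.
Qed.

Lemma transversal_mnm1 j m : 0 < deg (F j) m -> transversal_mnm [set j] m.
Proof.
move=> mj; exists (fun=> m); split=> [k /set1P -> //|].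
by rewrite big_set1 lepm_refl.
Qed.

Lemma transversal_mnmD J X m1 m2 : X \subset J ->
  transversal_mnm X m1 -> transversal_mnm (J :\: X) m2 ->
  transversal_mnm J (m1 + m2)%MM.
Proof.
move=> sXJ [phi1 [phi1F le1]] [phi2 [phi2F le2]].
exists (fun j => if j \in X then phi1 j else phi2 j); split=> [j jJ|].
  by case: ifP => jX; [apply: phi1F | apply: phi2F; rewrite inE jX].
rewrite (big_setID X) /= (setIidPr sXJ).
rewrite (eq_bigr phi1) => [|j -> //].
rewrite [X in (_ + X)%MM](eq_bigr phi2) => [|j /setDP [_ /negPf ->] //].
by apply/mnm_lepP => i; rewrite !mnmDE leq_add //; apply/mnm_lepP.
Qed.

(** The easy half of Hall's theorem: each factor [phi j] with [j] in [X] contributes at least one to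
    the degree in [cov X]. *)
Lemma transversal_mnm_hall J X m :
  transversal_mnm J m -> X \subset J -> #|X| <= deg (cov X) m.
Proof.
move=> [phi [phiF le_phi]] sXJ; apply: leq_trans (leq_deg _ le_phi).
rewrite deg_sum (big_setID X) /= (setIidPr sXJ) -sum1_card.
apply: leq_trans (leq_addr _ _); apply: leq_sum => j jX.
have phij := phiF j (subsetP sXJ j jX).
exact: leq_trans phij (deg_subset _ (cov_sup jX)).
Qed.

(* Halmos and Vaughan's argument for Hall's theorem: split at a tight proper
   subfamily if there is one, otherwise match one set arbitrarily. *)
Lemma hall_transversal_mnm J m :
  (forall X, X \subset J -> #|X| <= deg (cov X) m) -> transversal_mnm J m.
Proof.
have [k] := ubnP #|J|; elim: k J m => // k IHk J m; rewrite ltnS => leJk hallJ.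
have [->|[j jJ]] := set_0Vmem J.
  exists (fun=> 0%MM); split=> [j|]; first by rewrite inE.
  by rewrite big_set0; apply/mnm_lepP => i; rewrite mnm0E.
case: (pickP [pred X : {set T} |
  [&& X \proper J, X != set0 & #|X| == deg (cov X) m]]) => [X|noX].
  case/and3P => ltXJ X0 /eqP tightX; have sXJ := proper_sub ltXJ.
  rewrite -(restr_setC (cov X) m); apply: (transversal_mnmD sXJ); apply: IHk.
  - exact: leq_trans (proper_card ltXJ) leJk.
  - move=> Y sYX; rewrite deg_restr (setIidPl (covS sYX)).
    exact/hallJ/(subset_trans sYX).
  - apply: leq_trans leJk; rewrite cardsD (setIidPr sXJ).
    by rewrite ltn_subrL card_gt0 X0 (cardsD1 j) jJ.
  (* As [X] is tight, subtracting its equality from the inequality for [X :|: Y] leaves the one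
     required of [Y] outside [cov X]. *)
  move=> Y; rewrite subsetD => /andP [sYJ dYX].
  rewrite deg_restr -setDE -(leq_add2l #|X|) {2}tightX.
  rewrite -(degUI _ (_ : [disjoint cov X & _])); last first.
    by rewrite -setI_eq0 setIDA setIC -setIDA setDv setI0.
  rewrite setDE setUIr setUCr setIT -covU.
  have <- : #|X :|: Y| = #|X| + #|Y|.
    by rewrite cardsU setIC (disjoint_setI0 dYX) cards0 subn0.
  by apply: hallJ; rewrite subUset sXJ.
have /deg_gt0P [i iFj mi] : 0 < deg (F j) m.
  by rewrite -cov1 -(cards1 j) hallJ // sub1set.
have ->: m = (U_(i) + (m - U_(i)))%MM.
  by rewrite addmC submK // lep1mP -lt0n.
apply: (@transversal_mnmD _ [set j]); rewrite ?sub1set //.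
  by apply: transversal_mnm1; rewrite degU iFj.
apply: IHk => [|X sX]; first by rewrite (cardsD1 j) jJ in leJk.
have [->|X0] := eqVneq X set0; first by rewrite cards0.
have ltXJ : X \proper J.
  by apply: sub_proper_trans sX _; rewrite properD1.
(* No proper nonempty subfamily is tight, so [X] has at least one degree to spare, and dividing by
   the variable [i] costs at most one. *)
have := noX X; rewrite /= ltXJ X0 /= => /negbT.
have := hallJ _ (proper_sub ltXJ); rewrite leq_eqVlt => /orP [-> //|lt_deg _].
rewrite -ltnS; apply: leq_trans lt_deg _.
rewrite -{1}[m](@submK _ U_(i)%MM) ?lep1mP -?lt0n // degD degU addnC.
by rewrite -add1n leq_add2r leq_b1.
Qed.

(* Connectivity of the subgraph induced on [J] in the intersection graph
   of [F]. *)
Definition meet_connected J := J != set0 /\ forall X, X \subset J ->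
  X != set0 -> [disjoint cov X & cov (J :\: X)] -> X = J.

Lemma meet_connected1 j : meet_connected [set j].
Proof.
split=> [|X sX X0 _]; first by rewrite -card_gt0 cards1.
by apply/eqP; move: sX X0; rewrite subset1 => /orP [// | ->].
Qed.

(** A set [X] that is not connected splits into two parts with disjoint covers. Cardinals and
    degrees both add up, so the inequality for [X] follows by induction from those for the parts. *)
Lemma hall_meet_connected J m :
  (forall X, X \subset J -> meet_connected X -> #|X| <= deg (cov X) m) ->
  forall X, X \subset J -> #|X| <= deg (cov X) m.
Proof.
move=> hallJ X; have [k] := ubnP #|X|; elim: k X => // k IHk X; rewrite ltnS => leXk sXJ.
have [->|X0] := eqVneq X set0; first by rewrite cards0.
case: (pickP [pred Y : {set T} |
  [&& Y \proper X, Y != set0 & [disjoint cov Y & cov (X :\: Y)]]]) => [Y|noY].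
  case/and3P => ltYX Y0 dY; have sYX := proper_sub ltYX.
  have defX : X = Y :|: (X :\: Y) by rewrite -{1}(setID X Y) (setIidPr sYX).
  rewrite {2}defX covU degUI // -(cardsID Y X) (setIidPr sYX).
  rewrite leq_add // IHk ?(subset_trans _ sXJ) ?subsetDl //.
    exact: leq_trans (proper_card ltYX) leXk.
  apply: leq_trans leXk; rewrite cardsD (setIidPr sYX).
  by rewrite ltn_subrL !card_gt0 X0 Y0.
apply: hallJ => //; split=> // Y sYX Y0 dY.
have := noY Y; rewrite /= Y0 dY !andbT properEneq sYX andbT.
by move/negbFE/eqP.
Qed.

(** A largest nonempty subset of [J] with [P] is [J] itself: otherwise connectivity provides a
    further index whose set meets its cover. *)
Lemma meet_connected_ind J (P : {set T} -> Prop) : meet_connected J ->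
  (forall j, j \in J -> P [set j]) ->
  (forall X k, X \subset J -> k \in J -> k \notin X ->
     F k :&: cov X != set0 -> P X -> P (k |: X)) ->
  P J.
Proof.
move=> [/set0Pn [j jJ] connJ] P1 PU.
pose Q X := [&& X \subset J, X != set0 & `[< P X >]].
have Qj : Q [set j] by rewrite /Q sub1set jJ -card_gt0 cards1; apply/asboolP/P1.
case: (arg_maxnP (fun X => #|X|) Qj) => X /and3P [sXJ X0 /asboolP PX] maxX.
have [dX|] := boolP [disjoint cov X & cov (J :\: X)].
  by rewrite -(connJ X).
rewrite -setI_eq0 => /set0Pn [i /setIP [iX /bigcupP [k /setDP [kJ kX] ik]]].
suff /maxX : Q (k |: X) by rewrite /= cardsU1 kX add1n ltnn.
apply/and3P; split.
- by rewrite subUset sub1set kJ.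
- by apply/set0Pn; exists k; rewrite setU11.
- by apply/asboolP/PU => //; apply/set0Pn; exists i; rewrite inE ik.
Qed.

(** A cut of [W] with disjoint covers restricts to such a cut of [J], which connectivity forces to
    be trivial. *)
Lemma meet_connected_split J Z (W : {set T}) : meet_connected J -> J \subset W ->
  [disjoint cov Z & cov (W :\: Z)] -> J \subset Z \/ J \subset W :\: Z.
Proof.
move=> [_ connJ] sJW dZ; have [JZ0|JZ0] := eqVneq (J :&: Z) set0.
  by right; rewrite subsetD sJW -setI_eq0 JZ0 eqxx.
left; apply/setIidPl/connJ; rewrite ?subsetIl //.
apply: disjointWl (covS (subsetIr J Z)) (disjointWr _ dZ).
by apply/covS; rewrite setDIr setDv set0U setSD.
Qed.

Lemma meet_connectedU X Y : meet_connected X -> meet_connected Y ->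
  cov X :&: cov Y != set0 -> meet_connected (X :|: Y).
Proof.
move=> connX connY meetXY; split=> [|Z sZ Z0 dZ].
  by rewrite setU_eq0 negb_and connX.1.
have [sXZ|sXZ] := meet_connected_split connX (subsetUl X Y) dZ;
have [sYZ|sYZ] := meet_connected_split connY (subsetUr X Y) dZ.
- by apply/eqP; rewrite eqEsubset sZ subUset sXZ.
- case/negP: meetXY; rewrite setI_eq0.
  exact: disjointWl (covS sXZ) (disjointWr (covS sYZ) dZ).
- case/negP: meetXY; rewrite setIC setI_eq0.
  exact: disjointWl (covS sYZ) (disjointWr (covS sXZ) dZ).
case/set0Pn: Z0 => z zZ; have := subsetP sZ z zZ; rewrite inE.
by case/orP=> [/(subsetP sXZ)|/(subsetP sYZ)]; rewrite inE zZ.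
Qed.

Hypothesis F_neq0 : forall j, F j != set0.

(** Each added [F j] is nonempty and lies inside [cov J], so no cut can separate it from [J]. After
    this enlargement, every remaining [F j] has a variable outside [cov J]. *)
Lemma meet_connected_full J : meet_connected J ->
  meet_connected [set j | F j \subset cov J] /\
  cov [set j | F j \subset cov J] = cov J.
Proof.
set J' := [set j | _] => connJ.
have sJJ' : J \subset J' by apply/subsetP => j jJ; rewrite inE cov_sup.
have covJ' : cov J' = cov J.
  apply/eqP; rewrite eqEsubset (covS sJJ') andbT.
  by apply/bigcupsP => j; rewrite inE.
split=> //; split=> [|Z sZ Z0 dZ].
  have /set0Pn [j jJ] := connJ.1.
  by apply/set0Pn; exists j; apply: (subsetP sJJ').
have absurd j X Y : j \in J' -> j \in X -> J \subset Y ->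
    [disjoint cov X & cov Y] -> False.
  rewrite inE => sFj jX sJY dXY; case/negP: (F_neq0 j).
  rewrite -subset0 -(disjoint_setI0 dXY) subsetI cov_sup //=.
  exact: subset_trans sFj (covS sJY).
have [sJZ|sJZ] := meet_connected_split connJ sJJ' dZ.
  apply/eqP; rewrite eqEsubset sZ; apply/subsetP => j jJ'.
  case: (boolP (j \in Z)) => // jZ; exfalso.
  apply: (absurd j (J' :\: Z) Z) => //; first by rewrite inE jZ.
  by rewrite disjoint_sym.
have /set0Pn [z zZ] := Z0; exfalso.
exact: (absurd z Z (J' :\: Z) (subsetP sZ z zZ)).
Qed.

(* [v] is the product of one variable from [F j :&: F k] for each edge [jk] of
   a spanning tree: rooting the tree at a vertex [j] with [i \in F j] matches
   ['X_i] with [j] and every edge with its lower end. *)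
Lemma meet_connected_tree J : meet_connected J ->
  exists v : 'X_{1..n}, (mdeg v).+1 = #|J| /\
    forall i, i \in cov J -> transversal_mnm J (U_(i) + v)%MM.
Proof.
pose P X := exists v : 'X_{1..n}, (mdeg v).+1 = #|X| /\
  forall i, i \in cov X -> transversal_mnm X (U_(i) + v)%MM.
move=> connJ; apply: (@meet_connected_ind J P connJ) => [j jJ|X k sX kJ kX].
  exists 0%MM; rewrite mdeg0 cards1; split=> // i; rewrite cov1 => ij.
  by rewrite addm0; apply: transversal_mnm1; rewrite degU ij.
move=> /set0Pn [y /setIP [yk yX]] [v [cardX vX]].
exists (U_(y) + v)%MM; split=> [|i].
  by rewrite mdegD mdeg1 cardsU1 kX -cardX.
(* The variable [a] serves the new vertex [k], and [b] completes [v] for [X]. Of [i] and [y], the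
   one playing [a] depends on whether [i] lies in [F k] or in [cov X]. *)
have step a b : a \in F k -> b \in cov X ->
    transversal_mnm (k |: X) (U_(a) + (U_(b) + v))%MM.
  move=> ak bX; apply: (@transversal_mnmD _ [set k]); rewrite ?sub1set ?setU11 //.
    by apply: transversal_mnm1; rewrite degU ak.
  by rewrite setU1K //; apply: vX.
rewrite covU cov1 inE => /orP [ik|iX]; first exact: step.
by rewrite addmA (addmC U_(i)%MM) -addmA; apply: step.
Qed.

End Combinatorics.

Import GRing.Theory.
Local Open Scope ring_scope.
Local Open Scope classical_set_scope.

(** * Ideals and prime ideals of a commutative ring *)

Section IdealTheory.
Variable R : comNzRingType.
Implicit Types (I J G P : set R).

Lemma is_idealP I :
  is_ideal I <-> I 0 /\ forall a u v, I u -> I v -> I (a * u + v).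
Proof.
split=> [[I0 Ilin]|[I0 Ilin]]; split; rewrite ?inE //.
- by move: I0; rewrite inE.
- by move=> a u v Iu Iv; have := Ilin a u v; rewrite !inE; apply.
- by move=> a u v; rewrite !inE; apply: Ilin.
Qed.

Lemma idealMl I a u : is_ideal I -> I u -> I (a * u).
Proof. by move=> /is_idealP [I0 Ilin] Iu; rewrite -[_ * _]addr0; apply: Ilin. Qed.

Lemma ideal_sum I (T : eqType) (s : seq T) (f : T -> R) :
  is_ideal I -> (forall j, j \in s -> I (f j)) -> I (\sum_(j <- s) f j).
Proof.
move=> /is_idealP [I0 Ilin] If; rewrite big_seq.
elim/big_ind: _ => // u v Iu Iv; rewrite -[u]mul1r; exact: Ilin.
Qed.

Lemma ideal_gen_ideal G : is_ideal (ideal_gen G).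
Proof.
apply/is_idealP; split=> [I [/is_idealP [] //]|a u v Gu Gv I [idI sGI]].
by have /is_idealP [_ Ilin] := idI; apply: Ilin; [apply: Gu | apply: Gv].
Qed.

Lemma prime_is_ideal P : is_prime_ideal P -> is_ideal P.
Proof.
move=> [[P0 _ Plin] _]; apply/is_idealP; split=> [|a u v Pu Pv].
  by move: P0; rewrite inE.
by have := Plin a u v; rewrite !inE; apply.
Qed.

(** The complement of a prime ideal contains 1 and is closed under products. *)
Lemma prime_ideal_prod P (T : finType) (Q : pred T) (f : T -> R) :
  is_prime_ideal P -> P (\prod_(i | Q i) f i) -> exists2 i, Q i & P (f i).
Proof.
move=> [[_ P1 _] primeP] Pf; apply: contrapT => noP.
suff: ~ P (\prod_(i | Q i) f i) by [].
elim/big_ind: _ => [|u v Pu Pv Puv|i Qi Pi].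
- by move=> ?; case/negP: P1; rewrite inE.
- have := primeP u v; rewrite !inE => /(_ Puv).
  by case/orP; rewrite inE.
- by apply: noP; exists i.
Qed.

Lemma prime_ideal_exp P a k : is_prime_ideal P -> P (a ^+ k) -> P a.
Proof.
move=> primeP; rewrite -[k]card_ord -prodr_const.
by case/(prime_ideal_prod primeP).
Qed.

End IdealTheory.

(** * Monomial ideals described by supports *)

Section MonomialIdeals.
Variables (K : fieldType) (n : nat).
Implicit Types (f g : {mpoly K[n]}) (m : 'X_{1..n}) (U V W : set 'X_{1..n}).
Implicit Types (A B : {set 'I_n}).

(** For [U] closed upwards this is the monomial ideal spanned by [U]; arbitrary [U] are allowed so
    that the parts of a given degree are covered too. *)
Definition supp_in U : set {mpoly K[n]} := [set f | {in msupp f, forall m, U m}].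

Definition up_closed U := forall m m', (m <= m')%MM -> U m -> U m'.

Lemma supp_in0 U : supp_in U 0.
Proof. by move=> m; rewrite msupp0. Qed.

Lemma supp_inD U f g : supp_in U f -> supp_in U g -> supp_in U (f + g).
Proof.
by move=> Uf Ug m /msuppD_le; rewrite mem_cat => /orP [/Uf|/Ug].
Qed.

Lemma supp_inN U f : supp_in U f -> supp_in U (- f).
Proof. by move=> Uf m; rewrite (perm_mem (msuppN f)) => /Uf. Qed.

Lemma supp_inM U V W f g : (forall m1 m2, U m1 -> V m2 -> W (m1 + m2)%MM) ->
  supp_in U f -> supp_in V g -> supp_in W (f * g).
Proof.
move=> UVW Uf Vg m /msuppM_le /allpairsP [[m1 m2] /= [/Uf U1 /Vg V2 ->]].
exact: UVW.
Qed.

Lemma supp_inX U m : supp_in U 'X_[m] <-> U m.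
Proof.
split=> [|Um m']; first by apply; rewrite msuppX mem_head.
by rewrite msuppX inE => /eqP ->.
Qed.

Lemma supp_in_sub U V f : U `<=` V -> supp_in U f -> supp_in V f.
Proof. by move=> sUV Uf m /Uf /sUV. Qed.

Lemma supp_in_eq0 U f : supp_in U f -> supp_in (~` U) f -> f = 0.
Proof.
move=> Uf nUf; apply: contrapT => /eqP; rewrite -msupp_eq0.
case def_s: (msupp f) => [//|m s] _.
by have mf : m \in msupp f; [rewrite def_s mem_head | case: (nUf m mf (Uf m mf))].
Qed.

(** The second support is kept inside [msupp f], so that a degree bound known for [f] passes on to
    [f2]. *)
Lemma supp_in_split U f :
  exists f1 f2, [/\ f = f1 + f2, supp_in U f1 & supp_in [set m | m \in msupp f /\ ~ U m] f2].
Proof.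
have supp_sum V (P : pred 'X_{1..n}) : (forall m, m \in msupp f -> P m -> V m) ->
    supp_in V (\sum_(m <- msupp f | P m) f@_m *: 'X_[m]).
  move=> PV; rewrite big_seq_cond; elim/big_ind: _ => [|? ? |m /andP [mf Pm]].
  - exact: supp_in0.
  - exact: supp_inD.
  - by move=> m' /msuppZ_le; rewrite msuppX inE => /eqP ->; apply: PV.
exists (\sum_(m <- msupp f | `[< U m >]) f@_m *: 'X_[m]).
exists (\sum_(m <- msupp f | ~~ `[< U m >]) f@_m *: 'X_[m]); split.
- by rewrite {1}(mpolyE f) (bigID (fun m => `[< U m >])) /=.
- by apply: supp_sum => m _ /asboolP.
- by apply: supp_sum => m mf /asboolPn.
Qed.

Lemma supp_in_ideal U : up_closed U -> is_ideal (supp_in U).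
Proof.
move=> upU; apply/is_idealP; split=> [|a u v Uu Uv]; first exact: supp_in0.
apply: supp_inD => //; apply: (@supp_inM setT U) => // m1 m2 _.
exact/upU/lem_addl.
Qed.

Lemma supp_in_gen U (I : set {mpoly K[n]}) : is_ideal I ->
  (forall m, U m -> I 'X_[m]) -> supp_in U `<=` I.
Proof.
move=> idI UI f Uf; rewrite (mpolyE f); apply: (ideal_sum idI) => m mf.
by rewrite -mul_mpolyC; apply: (idealMl _ idI); apply/UI/Uf.
Qed.

Lemma up_closed_deg A k : up_closed [set m | (k <= deg A m)%N].
Proof. by move=> m m' le_m /= le_k; apply: leq_trans le_k (leq_deg A le_m). Qed.

Lemma varidealE A : varideal K A = supp_in [set m | (0 < deg A m)%N].
Proof.
apply/seteqP; split.
  apply: smallest_sub; first exact/supp_in_ideal/up_closed_deg.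
  by move=> _ [i /= iA <-]; apply/supp_inX; rewrite /= degU iA.
apply: supp_in_gen; first exact: ideal_gen_ideal.
move=> m /= /deg_gt0P [i iA mi].
rewrite -[m](@submK _ U_(i)%MM) ?lep1mP -?lt0n // mpolyXD.
apply: (idealMl _ (ideal_gen_ideal _)).
by apply: sub_gen_smallest; exists i.
Qed.

Lemma ideal_mul_supp_in U V : up_closed U -> up_closed V ->
  ideal_mul (supp_in U) (supp_in V) =
  supp_in [set m | exists m1 m2, [/\ U m1, V m2 & (m1 + m2 <= m)%MM]].
Proof.
move=> upU upV; apply/seteqP; split.
  apply: smallest_sub.
    apply: supp_in_ideal => m m' le_m [m1 [m2 [U1 V2 le12]]].
    by exists m1, m2; split=> //; apply: lepm_trans le_m.
  move=> _ [f Uf [g Vg <-]]; apply: (supp_inM _ Uf Vg) => m1 m2 U1 V2.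
  by exists m1, m2; split=> //; apply: lepm_refl.
apply: supp_in_gen => [|m [m1 [m2 [U1 V2 le12]]]]; first exact: ideal_gen_ideal.
rewrite -(submK le12) mpolyXD; apply: (idealMl _ (ideal_gen_ideal _)).
apply: sub_gen_smallest; exists 'X_[m1]; first exact/supp_inX.
by exists 'X_[m2]; [exact/supp_inX | rewrite -mpolyXD].
Qed.

Lemma prod_varidealE (T : finType) (F : T -> {set 'I_n}) :
  \big[@ideal_mul {mpoly K[n]}/setT]_j varideal K (F j) =
  supp_in (transversal_mnm F finset.setT).
Proof.
(* The induction runs over duplicate-free lists, since [phi] can choose only one factor per
   index. *)
suff prodE s : uniq s -> \big[@ideal_mul {mpoly K[n]}/setT]_(j <- s) varideal K (F j)
    = supp_in [set m | exists phi : T -> 'X_{1..n},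
        {in s, forall j, 0 < deg (F j) (phi j)}%N
        /\ (\sum_(j <- s) phi j <= m)%MM].
  rewrite prodE ?index_enum_uniq //; congr supp_in; apply/seteqP.
  split=> m [phi [phiF le_phi]]; exists phi; split.
  - by move=> j _; apply: phiF; rewrite mem_index_enum.
  - by rewrite (eq_bigl xpredT) // => j; rewrite inE.
  - by move=> j _; apply: phiF; rewrite inE.
  - by rewrite (eq_bigl (fun j => j \in finset.setT)) // => j; rewrite inE.
elim: s => [_|k s IHs /= /andP [ks us]].
  rewrite big_nil; apply/seteqP; split=> // f _ m _; exists (fun=> 0%MM).
  by split=> //; rewrite big_nil; apply/mnm_lepP => i; rewrite mnm0E.
rewrite big_cons IHs // varidealE ideal_mul_supp_in; first last.
- move=> m m' le_m [phi [phiF le_phi]]; exists phi; split=> //.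
  exact: lepm_trans le_m.
- exact: up_closed_deg.
congr supp_in; apply/seteqP; split=> m.
  move=> [m1 [m2 [/= m1F [phi [phiF le_phi]] le12]]].
  exists (fun j => if j == k then m1 else phi j); split=> [j|].
    by rewrite inE; case: eqP => [-> //|_ /= /phiF].
  rewrite big_cons eqxx; apply: lepm_trans le12; apply/mnm_lepP => i.
  rewrite !mnmDE leq_add2l; move: i; apply/mnm_lepP; apply: lepm_trans le_phi.
  rewrite big_seq [X in (_ <= X)%MM]big_seq.
  rewrite (eq_bigr phi) ?lepm_refl // => j js.
  by case: eqP => // jk; rewrite -jk js in ks.
move=> [phi [phiF]]; rewrite big_cons => le_phi.
exists (phi k), (\sum_(j <- s) phi j)%MM; split=> //=.
  by apply: phiF; rewrite mem_head.
exists phi; split=> [j js|]; last exact: lepm_refl.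
by apply: phiF; rewrite inE js orbT.
Qed.

(* The powers of [varideal K A] are [varideal K A]-primary: compare the parts of
   lowest degree in the variables of [A]. *)
Lemma supp_in_deg_primary A k f g : ~ varideal K A g ->
  supp_in [set m | (k <= deg A m)%N] (g * f) ->
  supp_in [set m | (k <= deg A m)%N] f.
Proof.
rewrite varidealE => Ag; elim: k => [|k IHk] gf; first by [].
have degf : supp_in [set m | (k <= deg A m)%N] f.
  by apply: IHk; apply: supp_in_sub gf => m /ltnW.
have [g0 [g1 [def_g g0A g1A]]] := supp_in_split [set m | deg A m = 0%N] g.
have [f0 [f1 [def_f f0A f1A]]] := supp_in_split [set m | deg A m = k] f.
have {}f1A : supp_in [set m | (k.+1 <= deg A m)%N] f1.
  apply: supp_in_sub f1A => m [/degf le_k /eqP ne_k] /=.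
  by rewrite ltn_neqAle eq_sym ne_k.
have {}g1A : supp_in [set m | (0 < deg A m)%N] g1.
  by apply: supp_in_sub g1A => m [_ /eqP] /=; rewrite lt0n.
suff f00 : f0 = 0 by rewrite def_f f00 add0r.
(* This product has degree exactly [k] in the variables of [A], yet differs from [g * f] only by
   terms of degree above [k]. So it vanishes, while [g0] is nonzero because [g] lies outside
   [varideal K A]. *)
have : g0 * f0 = 0.
  apply: (@supp_in_eq0 [set m | (k.+1 <= deg A m)%N]).
    have -> : g0 * f0 = g * f + - (g1 * f0 + g * f1).
      by rewrite {1 2}def_g def_f; ring.
    apply: supp_inD => //; apply: supp_inN; apply: supp_inD.
      apply: (supp_inM _ g1A f0A) => m1 m2 /= lt0 eqk.
      by rewrite degD eqk -add1n leq_add2r.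
    apply: (@supp_inM setT _ _ _ _ _ _ f1A) => // m1 m2 _.
    exact/up_closed_deg/lem_addl.
  apply: (supp_inM _ g0A f0A) => m1 m2 /= eq0 eqk.
  by rewrite degD eq0 eqk ltnn.
move/eqP; rewrite mulf_eq0 => /orP [/eqP g00|/eqP //].
by case: Ag; rewrite def_g g00 add0r.
Qed.

Lemma varideal_prime A : is_prime_ideal (varideal K A).
Proof.
have /is_idealP [A0 Alin] : is_ideal (varideal K A) by exact: ideal_gen_ideal.
split; first split.
- by rewrite inE.
- apply/negP; rewrite inE varidealE -mpolyX0 => /supp_inX.
  by rewrite /= deg0.
- by move=> a u v; rewrite !inE; apply: Alin.
move=> u v; rewrite !inE => Auv; apply/orP.
have [Au|Au] := pselect (varideal K A u); [left | right]; rewrite inE //.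
(* Primality is the case [k = 1] of primariness. *)
by rewrite varidealE; apply: (supp_in_deg_primary Au); rewrite -varidealE.
Qed.

Lemma varideal_inj : injective (@varideal K n).
Proof.
have memX A i : varideal K A 'X_i <-> i \in A.
  by rewrite varidealE supp_inX /= degU lt0b.
by move=> A B AB; apply/finset.setP => i; apply/idP/idP; rewrite -!memX AB.
Qed.

End MonomialIdeals.

(** * Associated primes of a product of ideals of variables *)

Section AssociatedPrimes.
Variables (K : fieldType) (n : nat) (T : finType) (F : T -> {set 'I_n}).
Hypothesis F_neq0 : forall j, F j != finset.set0.

(** This is the primary decomposition of the product, read on monomials. *)
Lemma transversal_mnm_connectedP m : transversal_mnm F finset.setT m <->
  forall J, meet_connected F J -> (#|J| <= deg (cov F J) m)%N.
Proof.
split=> [Fm J _|hallF].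
  by apply: (transversal_mnm_hall Fm); apply: finset.subsetT.
apply: hall_transversal_mnm; apply: hall_meet_connected => J _.
exact: hallF.
Qed.

Lemma Ass_transversal_sub :
  Ass (supp_in (transversal_mnm F finset.setT)) `<=`
  [set varideal K (cov F J) | J in meet_connected F].
Proof.
move=> P [primeP [f defP]].
have idP := prime_is_ideal primeP.
(* ['X_[x] * f] is not in the ideal, so it violates the degree condition for
   some [J]; as ['X_[x]] has degree at least [#|J|] in each variable outside
   [P], all the variables of [cov F J] lie in [P]. *)
pose x := (\sum_(i | ~~ `[< P 'X_i >]) U_(i) *+ #|T|)%MM.
have nPx : ~ P 'X_[x].
  rewrite /x (big_morph _ (@mpolyXD n K) (@mpolyX0 n K)) => /(prime_ideal_prod primeP) [i /asboolPn nPi].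
  by rewrite -mpolyXn => /(prime_ideal_exp primeP).
have [J [connJ nJxf]] : exists J, meet_connected F J /\
    ~ supp_in [set m | (#|J| <= deg (cov F J) m)%N] ('X_[x] * f).
  apply: contrapT => noJ; apply: nPx; rewrite defP => m mxf.
  apply/transversal_mnm_connectedP => J connJ; apply: contrapT => nJm.
  by apply: noJ; exists J; split=> // /(_ m mxf).
have idJ : is_ideal (supp_in (K := K) [set m | (#|J| <= deg (cov F J) m)%N]).
  exact/supp_in_ideal/up_closed_deg.
exists J => //; apply/seteqP; split.
  apply: smallest_sub => // _ [i /= iJ <-]; apply: contrapT => nPi.
  apply: nJxf; rewrite mulrC.
  apply: (idealMl f idJ).
  apply/supp_inX; rewrite /= deg_sum (bigD1 i) /=; last exact/asboolPn.
  by rewrite degMn degU iJ mul1n; apply: leq_trans (max_card _) (leq_addr _ _).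
(* If [a] annihilates [f] modulo the ideal but lies outside [varideal K (cov F J)], primariness
   gives [f], hence its multiple by ['X_[x]], the degree that the latter lacks. *)
move=> a; rewrite defP => If_a; apply: contrapT => nJa; apply: nJxf.
apply: (idealMl _ idJ).
apply: (supp_in_deg_primary nJa); apply: supp_in_sub If_a => m.
by move/transversal_mnm_connectedP; apply.
Qed.

(** The witness is ['X_[v + w]]: [v] falls one variable of [A] short of serving all [F j] inside
    [A], and [w] serves the other [F j] without using [A]. *)
Lemma Ass_transversal_sup J : meet_connected F J ->
  Ass (supp_in (transversal_mnm F finset.setT)) (varideal K (cov F J)).
Proof.
move=> connJ; split; first exact: varideal_prime.
have [connJ' covJ'] := meet_connected_full F_neq0 connJ.
move: connJ' covJ'; set A := cov F J; set J' := finset _ => connJ' covJ'.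
have [v [cardJ' treeJ']] := meet_connected_tree connJ'.
(* Taking all the variables of [F j] outside [A] at once avoids choosing one. *)
pose phi j : 'X_{1..n} := restr (F j :\: A)%SET [multinom 1%N | _ < n].
pose w := (\sum_(j in finset.setT :\: J') phi j)%MM.
have tw : transversal_mnm F (finset.setT :\: J') w.
  exists phi; split=> [j|]; last exact: lepm_refl.
  rewrite !inE andbT => /fintype.subsetPn [i iFj iA].
  apply/deg_gt0P; exists i => //; rewrite mnmE !inE iFj iA mnmE //.
have deg_w : deg A w = 0%N.
  rewrite deg_sum big1 // => j _; rewrite deg_restr.
  rewrite finset.setIDA finset.setIC -finset.setIDA finset.setDv.
  by rewrite finset.setI0 /deg big_set0.
exists 'X_[v + w]; rewrite varidealE; apply/seteqP; split=> a.
  move=> Aa; apply: (supp_inM _ Aa (V := [set (v + w)%MM])) => [m _ /= mA ->|].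
    have /deg_gt0P [i iA mi] := mA.
    apply: (@transversal_mnm_le _ _ _ _ (U_(i) + v + w)%MM).
      rewrite -addmA; apply/mnm_lepP => k; rewrite mnmDE [leqRHS]mnmDE.
      by rewrite leq_add2r; apply/mnm_lepP; rewrite lep1mP -lt0n.
    apply: transversal_mnmD tw; first exact: finset.subsetT.
    by apply: treeJ'; rewrite covJ'.
  exact/supp_inX.
move=> Ia m ma /=.
have /transversal_mnm_hall : transversal_mnm F finset.setT (m + (v + w))%MM.
  by apply: Ia; rewrite mcoeff_msupp addmC mcoeffMX -mcoeff_msupp.
(* Hall's inequality for [J'] requires degree [(mdeg v).+1] in [A]. Since [v] supplies at most
   [mdeg v] and [w] nothing, [m] must involve a variable of [A]. *)
move=> /(_ _ (finset.subsetT J')); rewrite covJ' !degD deg_w addn0 -cardJ'.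
move=> lt_v; rewrite -(ltn_add2r (deg A v)) add0n.
exact: leq_ltn_trans (deg_mdeg A v) lt_v.
Qed.

End AssociatedPrimes.

Theorem corollary3p9 (K : fieldType) (n : nat) :
  (forall F : set {set 'I_n},
     F !=set0 -> ~ F finset.set0 -> meeting_union_closed F ->
     exists I : set {mpoly K[n]},
       transversal_polymatroidal I /\ Ass I = [set varideal K A | A in F]) /\
  (forall I : set {mpoly K[n]},
     transversal_polymatroidal I ->
     meeting_union_closed [set A : {set 'I_n} | Ass I (varideal K A)]).
Proof.
split=> [F [A0 FA0] F0 closedF|_ [r [G [r_gt0 G0 ->]]] A B].
  (* Each member of the family serves as a factor exactly once. *)
  pose E : {set {set 'I_n}} := finset (fun A => `[< F A >]).
  have EP A : reflect (F A) (A \in E) by rewrite inE; apply: asboolP.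
  pose G (i : 'I_#|E|) : {set 'I_n} := enum_val i.
  have FG i : F (G i) by apply/EP; apply: enum_valP.
  have G0 i : G i != finset.set0.
    by apply/eqP => Gi0; apply: F0; rewrite -Gi0.
  exists (\big[@ideal_mul {mpoly K[n]}/setT]_i varideal K (G i)); split.
    exists #|E|, G; split=> //.
    by rewrite finset.card_gt0; apply/finset.set0Pn; exists A0; apply/EP.
  rewrite prod_varidealE; apply/seteqP; split.
    move=> P /Ass_transversal_sub [J connJ <-]; exists (cov G J) => //.
    (* The closure condition on the family is the induction step that adds an index whose set meets
       the cover. *)
    pose Q X := F (cov G X).
    apply: (@meet_connected_ind _ _ G J Q connJ) => [j _|X k _ _ _ meetX FX].
      by rewrite /Q cov1.
    by rewrite /Q covU cov1; apply: closedF.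
  move=> _ [A FA <-]; have /EP EA := FA.
  (* A member of the family is the cover of a single index, which is connected. *)
  rewrite -(enum_rankK_in EA EA) -/(G _) -cov1.
  exact/Ass_transversal_sup/meet_connected1.
rewrite prod_varidealE /= => /Ass_transversal_sub [J connJ /varideal_inj <-].
move=> /Ass_transversal_sub [L connL /varideal_inj <-] meetJL.
by rewrite -covU; apply/Ass_transversal_sup => //; apply: meet_connectedU.
Qed.
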